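(* Let $\kappa$ be an infinite cardinal and let $X$ be an $(\ell_\infty(\omega_0),\kappa)$-octahedral real Banach space. Then, given any uncountable cardinal $\alpha$, there exists a countably incomplete ultrafilter $\mathcal U$ over some infinite set $J$ such that the ultrapower $X_{\mathcal U}$ is $(\ell_\infty(\alpha),\kappa)$-rigid octahedral.
   Context: For a cardinal $\alpha'$, $\ell_\infty(\alpha')$ is the space of bounded real functions on a set of cardinality $\alpha'$ with the supremum norm. For infinite cardinals $\alpha,\beta$, a Banach space $X$ is $(\ell_\infty(\alpha),\beta)$-octahedral if for every subset $Z\subseteq X$ with $|Z|<\beta$, every cardinal $\alpha'<\alpha$ and every $\varepsilon>0$ there exists a bounded linear operator $\phi:\ell_\infty(\alpha')\longrightarrow X$ with $\Vert\phi\Vert\leq 1$ such that $\Vert z+\phi(y)\Vert\geq (1-\varepsilon)(\Vert z\Vert+\Vert y\Vert)$ for every $z\in Z$ and $y\in\ell_\infty(\alpha')$. It is $(\ell_\infty(\alpha),\beta)$-rigid octahedral if the same condition holds with $\varepsilon=0$ (so that $\Vert z+\phi(y)\Vert=\Vert z\Vert+\Vert y\Vert$ for every $z\in Z$, $y\in\ell_\infty(\alpha')$). An ultrafilter $\mathcal U$ over $J$ is countably incomplete if there is a sequence $(A_n)$ in $\mathcal U$ with $\bigcap_n A_n=\emptyset$ (such an ultrafilter is free). The ultrapower is $X_{\mathcal U}:=\ell_\infty(J,X)/N_{\mathcal U}$, where $\ell_\infty(J,X)$ is the space of bounded functions $f:J\to X$ with the supremum norm and $N_{\mathcal U}=\{f:\lim_{\mathcal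 U}\Vert f(j)\Vert=0\}$; its quotient norm is $\Vert [x_j]_{\mathcal U}\Vert=\lim_{\mathcal U}\Vert x_j\Vert$. *)

(* Defs.v *)
From HB Require Import structures.
From mathcomp Require Import all_boot all_order all_algebra ring_quotient lra.
From mathcomp Require Import all_classical all_reals all_analysis.

Set Implicit Arguments.
Unset Strict Implicit.
Unset Printing Implicit Defensive.

Import Order.TTheory GRing.Theory Num.Theory.
Import numFieldNormedType.Exports.

Local Open Scope classical_set_scope.
Local Open Scope card_scope.
Local Open Scope ring_scope.
Local Open Scope quotient_scope.

(* A cardinal is given by a type of that cardinality. All binders of type
   [cardinal] range over one and the same universe, so that quantifying over
   [beta : cardinal] with [beta] smaller than [alpha : cardinal] does reach
   every cardinal below [alpha]. *)
Definition cardinal := Type.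

Definition card_lt T U (A : set T) (B : set U) := (A #<= B) && ~~ (B #<= A).
Notation "A '#<' B" := (card_lt A B) (at level 79) : card_scope.

Section linfty.
Context {R : realType} (T : Type) (X : normedModType R).

Definition bounded_pred : {pred T -> X} := mem (bounded_fun : set (T -> X)).

Record linfty := Linfty {
  linfty_fun :> T -> X ;
  _ : linfty_fun \in bounded_pred }.

HB.instance Definition _ := [isSub for linfty_fun].
HB.instance Definition _ := gen_eqMixin linfty.
HB.instance Definition _ := gen_choiceMixin linfty.

Lemma bounded_predP (f : T -> X) :
  reflect (exists M, forall t, `|f t| <= M) (f \in bounded_pred).
Proof.
apply: (iffP idP) => [|[M fM]].
  rewrite inE /= => /pinfty_ex_gt0[M _ fM].
  by exists M => t; exact: fM.
rewrite inE /=; exists M; split; first exact: num_real.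
by move=> x Mx t _ /=; rewrite (le_trans (fM t))// ltW.
Qed.

Lemma linftyP (f : linfty) : exists M, forall t, `|f t| <= M.
Proof. exact/bounded_predP/(valP f). Qed.

Fact bounded_pred_submod : submod_closed bounded_pred.
Proof.
split; first by apply/bounded_predP; exists 0 => t; rewrite normr0.
move=> a f g /bounded_predP[M fM] /bounded_predP[N gN].
apply/bounded_predP; exists (`|a| * M + N) => t.
rewrite (le_trans (ler_normD _ _))// lerD// normrZ.
by rewrite ler_wpM2l.
Qed.
HB.instance Definition _ :=
  GRing.isSubmodClosed.Build R (T -> X) bounded_pred bounded_pred_submod.
HB.instance Definition _ := [SubChoice_isSubLmodule of linfty by <:].

Lemma linfty_addE (f g : linfty) t : (f + g) t = f t + g t.
Proof. by []. Qed.
Lemma linfty_oppE (f : linfty) t : (- f) t = - f t.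
Proof. by []. Qed.
Lemma linfty_scaleE (a : R) (f : linfty) t : (a *: f) t = a *: f t.
Proof. by []. Qed.
Lemma linfty_zeroE t : (0 : linfty) t = 0.
Proof. by []. Qed.

(* When [T] is empty this is [sup set0 = 0]. *)
Definition linfty_norm (f : linfty) : R := sup (range (fun t => `|f t|)).

Lemma linfty_norm_ub (f : linfty) t : `|f t| <= linfty_norm f.
Proof.
have [M fM] := linftyP f.
apply: ub_le_sup; last by exists t.
by exists M => _ [s _ <-].
Qed.

Lemma linfty_norm_le (f : linfty) M :
  0 <= M -> (forall t, `|f t| <= M) -> linfty_norm f <= M.
Proof.
move=> M0 fM; rewrite /linfty_norm.
have [->|/set0P ne] := eqVneq (range (fun t => `|f t|)) set0.
  by rewrite sup0.
by apply: ge_sup => // _ [t _ <-].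
Qed.

Lemma linfty_norm_ge0 (f : linfty) : 0 <= linfty_norm f.
Proof.
have [T0|/set0P[t _]] := eqVneq [set: T] set0.
  by rewrite /linfty_norm T0 image_set0 sup0.
exact: le_trans (linfty_norm_ub f t).
Qed.

Fact linfty_normD (f g : linfty) :
  linfty_norm (f + g) <= linfty_norm f + linfty_norm g.
Proof.
apply: linfty_norm_le => [|t]; first by rewrite addr_ge0// linfty_norm_ge0.
by rewrite (le_trans (ler_normD _ _))// lerD// linfty_norm_ub.
Qed.

Fact linfty_normZ (a : R) (f : linfty) :
  linfty_norm (a *: f) = `|a| * linfty_norm f.
Proof.
have le b g : linfty_norm (b *: g) <= `|b| * linfty_norm g.
  apply: linfty_norm_le => [|t]; first by rewrite mulr_ge0// linfty_norm_ge0.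
  by rewrite linfty_scaleE normrZ ler_wpM2l// linfty_norm_ub.
apply/eqP; rewrite eq_le le/=.
have [->|a0] := eqVneq a 0; first by rewrite normr0 mul0r linfty_norm_ge0.
rewrite -ler_pdivlMl ?normr_gt0//.
rewrite (le_trans _ (le_trans (le a^-1 (a *: f)) _))//.
- by rewrite scalerA mulVf// scale1r.
- by rewrite normfV.
Qed.

Fact linfty_norm_eq0 (f : linfty) : linfty_norm f = 0 -> f = 0.
Proof.
move=> f0; apply/val_inj/funext => t /=; apply/eqP.
by rewrite -normr_le0 -f0 linfty_norm_ub.
Qed.

HB.instance Definition _ := Lmodule_isNormed.Build R linfty
  linfty_normD linfty_normZ linfty_norm_eq0.

Lemma linfty_normE (f : linfty) : `|f| = sup (range (fun t => `|f t|)).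
Proof. by []. Qed.

Lemma linfty_dist (f g : linfty) t : `|f t - g t| <= `|f - g|.
Proof. exact: linfty_norm_ub (f - g) t. Qed.

End linfty.

Section linfty_complete.
Context {R : realType} (T : Type) (X : completeNormedModType R).

Fact linfty_cauchy_cvg (F : set_system (linfty T X)) :
  ProperFilter F -> cauchy F -> cvg F.
Proof.
move=> FF /cauchy_ballP Fc.
have Fc' e : 0 < e -> exists2 f : linfty T X, F (ball f e) & True.
  by move=> e0; have /cauchy_ballP/cauchyP/(_ e e0)[f Ff] := Fc; exists f.
pose ev t (f : linfty T X) : X := f t.
have evc t : cvg (ev t @ F).
  apply: cauchy_cvg; apply: cauchy_exP => e e0.
  have [f Ff _] := Fc' e e0; exists (f t).
  suff : F (ev t @^-1` ball (f t) e) by [].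
  apply: filterS Ff => h; rewrite /= -!ball_normE /= => fh.
  exact: le_lt_trans (linfty_dist f h t) fh.
pose g t : X := lim (ev t @ F).
have gc e f : F (ball f e) -> forall t, `|f t - g t| <= e.
  move=> Ff t.
  have fg : (fun h => `|f t - ev t h|) @ F --> `|f t - g t|.
    by apply: cvg_norm; apply: cvgB; [exact: cvg_cst|exact: evc].
  rewrite -(cvg_lim _ fg)//; apply: limr_le; first by apply/cvg_ex; exists `|f t - g t|.
  apply: filterS Ff => h; rewrite -ball_normE /= => fh.
  exact/ltW/(le_lt_trans (linfty_dist f h t)).
have gb : g \in @bounded_pred _ T X.
  have [f Ff _] := Fc' 1 ltr01.
  apply/bounded_predP; exists (1 + `|f|) => t.
  rewrite -[g t](subrK (f t)) (le_trans (ler_normD _ _))// lerD//.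
    by rewrite distrC gc.
  exact: linfty_norm_ub.
apply/cvg_ex; exists (Linfty gb).
apply/cvgrPdist_le => e e0.
have e20 : 0 < e / 2 by rewrite divr_gt0.
have [f Ff _] := Fc' _ e20.
apply: filterS (Ff) => h; rewrite -ball_normE /= => fh.
apply: linfty_norm_le => [|t]; first exact: ltW.
rewrite -[linfty_fun _ t]/(g t - h t) -(subrKA (f t)).
rewrite (le_trans (ler_normD _ _))// (splitr e) lerD//.
  by rewrite distrC gc.
exact/ltW/(le_lt_trans (linfty_dist f h t)).
Qed.

HB.instance Definition _ :=
  Uniform_isComplete.Build (linfty T X) linfty_cauchy_cvg.

End linfty_complete.

Section ultrapower.
Context {R : realType} (J : Type) (X : completeNormedModType R).
Context (U : set_system J) (UF : UltraFilter U).

Definition null_pred : {pred linfty J X} :=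
  fun f => `[< (fun j => `|f j|) @ U --> (0 : R) >].

Lemma null_predP (f : linfty J X) :
  reflect ((fun j => `|f j|) @ U --> (0 : R)) (f \in null_pred).
Proof. exact: asboolP. Qed.

Lemma null_pred0 (f : linfty J X) : f \in null_pred <-> f @ U --> (0 : X).
Proof.
split=> [/null_predP|f0]; first exact: norm_cvg0.
by apply/null_predP; rewrite -(@normr0 _ X); exact: cvg_norm.
Qed.

Fact null_pred_submod : submod_closed null_pred.
Proof.
split; first by apply/null_pred0; exact: cvg_cst.
move=> a f g /null_pred0 f0 /null_pred0 g0; apply/null_pred0.
rewrite -(addr0 (0 : X)) -{1}(scaler0 X a).
by apply: cvgD => //; exact: cvgZr.
Qed.
HB.instance Definition _ :=
  GRing.isSubmodClosed.Build R (linfty J X) null_pred null_pred_submod.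

Definition ultrapower := Quotient.quot null_pred.

HB.instance Definition _ := GRing.Zmodule.on ultrapower.

Definition ultraclass (f : linfty J X) : ultrapower := \pi_ultrapower f.

Lemma ultraclassP (q : ultrapower) : exists f, ultraclass f = q.
Proof. by exists (repr q); exact: reprK. Qed.

Lemma ultraclass_eq (f g : linfty J X) :
  ultraclass f = ultraclass g <-> f - g \in null_pred.
Proof. by rewrite Quotient.idealrBE; split=> [/eqP|/eqP]. Qed.

Fact ultraclass_zmod : zmod_morphism ultraclass.
Proof. by move=> f g; rewrite /ultraclass !piE. Qed.
HB.instance Definition _ :=
  GRing.isZmodMorphism.Build (linfty J X) ultrapower ultraclass ultraclass_zmod.

Definition ultrapower_scale (a : R) (q : ultrapower) : ultrapower :=
  ultraclass (a *: repr q).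

Fact ultrapower_scaleE a f :
  ultrapower_scale a (ultraclass f) = ultraclass (a *: f).
Proof.
apply/ultraclass_eq; rewrite -scalerBr rpredZ//.
by apply/ultraclass_eq; exact: reprK.
Qed.

Fact ultrapower_scaleA a b q :
  ultrapower_scale a (ultrapower_scale b q) = ultrapower_scale (a * b) q.
Proof.
by have [f <-] := ultraclassP q; rewrite !ultrapower_scaleE scalerA.
Qed.

Fact ultrapower_scale1 : left_id 1 ultrapower_scale.
Proof.
by move=> q; have [f <-] := ultraclassP q; rewrite ultrapower_scaleE scale1r.
Qed.

Fact ultrapower_scaleDr : right_distributive ultrapower_scale +%R.
Proof.
move=> a p q; have [f <-] := ultraclassP p; have [g <-] := ultraclassP q.
by rewrite -raddfD !ultrapower_scaleE scalerDr raddfD.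
Qed.

Fact ultrapower_scaleDl q : {morph ultrapower_scale^~ q : a b / a + b}.
Proof.
move=> a b; have [f <-] := ultraclassP q.
by rewrite !ultrapower_scaleE scalerDl raddfD.
Qed.

HB.instance Definition _ := GRing.Zmodule_isLmodule.Build R ultrapower
  ultrapower_scaleA ultrapower_scale1 ultrapower_scaleDr ultrapower_scaleDl.

Fact ultraclass_scalable : scalable ultraclass.
Proof. by move=> a f; rewrite -ultrapower_scaleE. Qed.
HB.instance Definition _ := GRing.isScalable.Build R (linfty J X) ultrapower
  *:%R ultraclass ultraclass_scalable.

Definition ultrapower_norm (q : ultrapower) : R :=
  lim ((fun j => `|repr q j|) @ U).

Lemma fmap_ultra (Y : Type) (h : J -> Y) : UltraFilter (h @ U).
Proof.
split; first exact: fmap_proper_filter.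
move=> G GF UG; apply/seteqP; split => // B GB.
have [//|hB] := in_ultra_setVsetC (h @^-1` B) UF.
have /filter_ex[y []//] : G (B `&` ~` B) by apply: filterI => //; exact: UG.
Qed.

Lemma is_cvg_ultra_norm (f : linfty J X) : cvg ((fun j => `|f j|) @ U).
Proof.
have [M fM] := linftyP f.
have := @segment_compact R 0 M; rewrite compact_ultra.
move=> /(_ ((fun j => `|f j|) @ U) (fmap_ultra _)) [].
  suff : U [set j | `|f j| \in `[0, M]] by [].
  by apply: filterE => j /=; rewrite in_itv/= normr_ge0 fM.
by move=> l [_ fl]; apply/cvg_ex; exists l.
Qed.

Lemma cvg_ultrapower_norm (f : linfty J X) :
  (fun j => `|f j|) @ U --> ultrapower_norm (ultraclass f).
Proof.
suff -> : ultrapower_norm (ultraclass f) = lim ((fun j => `|f j|) @ U).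
  exact: is_cvg_ultra_norm.
set g := repr (ultraclass f).
have /ultraclass_eq/null_pred0 gf0 : ultraclass g = ultraclass f by exact: reprK.
have gfN : (fun j => `|g j| - `|f j|) @ U --> (0 : R).
  apply: norm_cvg0.
  apply: (squeeze_cvgr (f := fun=> 0) (h := fun j => `|(g - f) j|)).
  - by apply: filterE => j; rewrite normr_ge0/= ler_dist_dist.
  - exact: cvg_cst.
  - exact/null_predP/null_pred0.
have := cvgB (@is_cvg_ultra_norm g) gfN; rewrite subr0 => gf.
rewrite /ultrapower_norm -/g; apply/esym/(@cvg_lim R^o) => //.
have -> : (fun j => `|f j|) = (fun j => `|g j| - (`|g j| - `|f j|)).
  by apply/funext => j; rewrite subKr.
exact: gf.
Qed.

Fact ultrapower_normD p q :
  ultrapower_norm (p + q) <= ultrapower_norm p + ultrapower_norm q.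
Proof.
have [f <-] := ultraclassP p; have [g <-] := ultraclassP q.
rewrite -raddfD -subr_le0.
have fg : (fun j => `|(f + g) j| - (`|f j| + `|g j|)) @ U -->
    ultrapower_norm (ultraclass (f + g)) -
    (ultrapower_norm (ultraclass f) + ultrapower_norm (ultraclass g)).
  apply: cvgB; first exact: cvg_ultrapower_norm.
  by apply: cvgD; exact: cvg_ultrapower_norm.
rewrite -(cvg_lim (@Rhausdorff R) fg); apply: limr_le.
  by apply/cvg_ex; eexists; exact: fg.
by apply: filterE => j; rewrite subr_le0; exact: ler_normD.
Qed.

Fact ultrapower_normZ a q : ultrapower_norm (a *: q) = `|a| * ultrapower_norm q.
Proof.
have [f <-] := ultraclassP q; rewrite -linearZ.
apply: (cvg_unique (@Rhausdorff R) (@cvg_ultrapower_norm _)).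
have -> : (fun j => `|(a *: f) j|) = (fun j => `|a| * `|f j|).
  by apply/funext => j; rewrite linfty_scaleE normrZ.
exact: cvgMr (@cvg_ultrapower_norm f).
Qed.

Fact ultrapower_norm_eq0 q : ultrapower_norm q = 0 -> q = 0.
Proof.
have [f <-] := ultraclassP q => f0.
rewrite -(raddf0 ultraclass); apply/ultraclass_eq; rewrite subr0.
by apply/null_predP; rewrite -f0; exact: cvg_ultrapower_norm.
Qed.

HB.instance Definition _ := Lmodule_isNormed.Build R ultrapower
  ultrapower_normD ultrapower_normZ ultrapower_norm_eq0.

Lemma ultraclass_norm (f : linfty J X) :
  `|ultraclass f| = lim ((fun j => `|f j|) @ U).
Proof. by apply/esym/(@cvg_lim R^o) => //; exact: cvg_ultrapower_norm. Qed.

Lemma ultraclass_norm_le (f : linfty J X) : `|ultraclass f| <= `|f|.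
Proof.
rewrite ultraclass_norm; apply: limr_le; first exact: is_cvg_ultra_norm.
by apply: filterE => j; exact: linfty_norm_ub.
Qed.

Lemma ultrapower_lift (q : ultrapower) (r : R) :
  `|q| < r -> exists2 f, ultraclass f = q & `|f| <= r.
Proof.
have [f <-] := ultraclassP q => fr.
have r0 : 0 <= r by rewrite (le_trans _ (ltW fr)).
pose g j : X := if `|f j| <= r then f j else 0.
have gr j : `|g j| <= r by rewrite /g; case: ifPn => // _; rewrite normr0.
have gb : g \in @bounded_pred _ J X by apply/bounded_predP; exists r.
exists (Linfty gb); last exact: linfty_norm_le.
apply/ultraclass_eq/null_pred0; apply: cvg_near_cst.
have : U [set j | `|f j| < r] by apply: (cvgr_lt _ (@cvg_ultrapower_norm f)).
apply: filterS => j /= /ltW fjr.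
by rewrite -[LHS]/(g j - f j) /g fjr subrr.
Qed.

(* The norm of [ultrapower] is the quotient norm. *)
Lemma ultrapower_norm_inf (q : ultrapower) :
  `|q| = inf [set `|f| | f in [set f | ultraclass f = q]].
Proof.
have lb : lbound [set `|f| | f in [set f | ultraclass f = q]] `|q|.
  by move=> _ [f /= <- <-]; exact: ultraclass_norm_le.
have ne : [set `|f| | f in [set f | ultraclass f = q]] !=set0.
  by have [f fq] := ultraclassP q; exists `|f|, f.
apply/eqP; rewrite eq_le; apply/andP; split; first exact: lb_le_inf.
apply/ler_addgt0Pr => e e0.
have [|f fq fr] := @ultrapower_lift q (`|q| + e); first by rewrite ltrDl.
rewrite (le_trans _ fr)//; apply: ge_inf; last by exists f.
by exists `|q|.
Qed.

Fact ultrapower_cauchy_cvg (F : set_system ultrapower) :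
  ProperFilter F -> cauchy F -> cvg F.
Proof.
move=> FF Fc.
pose d n : R := 2^-1 ^+ n.
have d0 n : 0 < d n by rewrite exprn_gt0// invr_gt0.
have dS n : d n = d n.+1 + d n.+1 by rewrite /d exprS; lra.
have /choice[x Fx] : forall n, exists x : ultrapower, F (ball x (d n)).
  by move=> n; move/cauchyP : Fc; exact.
have xx n : `|x n.+1 - x n| < d n + d n.+1.
  have /filter_ex[y []] : F (ball (x n) (d n) `&` ball (x n.+1) (d n.+1)).
    by apply: filterI; exact: Fx.
  rewrite -!ball_normE /= => xy xSy.
  rewrite -(subrKA y) addrC (le_lt_trans (ler_normD _ _))// ltrD//.
  by rewrite distrC.
have /choice[h hE] : forall n, exists h : linfty J X,
    ultraclass h = x n.+1 - x n /\ `|h| <= d n + d n.+1.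
  by move=> n; have [h ? ?] := ultrapower_lift (xx n); exists h.
have [y0 y0E] := ultraclassP (x 0%N).
pose y n := y0 + \sum_(i < n) h i.
have yE n : ultraclass (y n) = x n.
  rewrite /y raddfD /= y0E; elim: n => [|n IH].
    by rewrite big_ord0 raddf0 addr0.
  by rewrite big_ord_recr/= raddfD/= addrA IH (hE n).1 subrKC.
have yS n m : `|y (n + m)%N - y n| <= 3 * (d n - d (n + m)%N).
  elim: m => [|m IH]; first by rewrite addn0 !subrr normr0 mulr0.
  rewrite addnS /y big_ord_recr/= addrA -/(y _) addrAC.
  rewrite (le_trans (ler_normD _ _))// (le_trans (lerD IH (hE _).2))//.
  by have := dS (n + m)%N; lra.
have yd n m : `|y (n + m)%N - y n| <= 3 * d n.
  by rewrite (le_trans (yS n m))// ler_wpM2l// gerBl ltW.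
have dcvg : d @ \oo --> (0 : R).
  by apply: cvg_expr; rewrite ger0_norm// invf_lt1// ltr1n.
have yc : cvg (y @ \oo).
  apply: cauchy_cvg; apply: cauchy_exP => e e0.
  have e30 : 0 < e / 3 by rewrite divr_gt0.
  have /filter_ex[n dn] : \forall n \near \oo, d n < e / 3.
    exact: (cvgr_lt _ dcvg).
  exists (y n); exists n => // m /= nm.
  rewrite -ball_normE /= distrC -(subnKC nm) (le_lt_trans (yd _ _))//.
  by rewrite mulrC -ltr_pdivlMr.
have yn n : `|lim (y @ \oo) - y n| <= 3 * d n.
  have yl : (fun k => `|y k - y n|) @ \oo --> `|lim (y @ \oo) - y n|.
    by apply: cvg_norm; apply: cvgB => //; exact: cvg_cst.
  rewrite -(cvg_lim (@Rhausdorff R) yl); apply: limr_le.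
    by apply/cvg_ex; eexists; exact: yl.
  by exists n => // k /= nk; rewrite -(subnKC nk).
apply/cvg_ex; exists (ultraclass (lim (y @ \oo))).
apply/cvgrPdist_lt => e e0.
have e40 : 0 < e / 4 by rewrite divr_gt0.
have /filter_ex[n dn] : \forall n \near \oo, d n < e / 4.
  exact: (cvgr_lt _ dcvg).
apply: filterS (Fx n) => q; rewrite -ball_normE /= => xq.
rewrite -(subrKA (x n)) (le_lt_trans (ler_normD _ _))//.
have : `|ultraclass (lim (y @ \oo)) - x n| <= 3 * d n.
  by rewrite -yE -raddfB (le_trans (ultraclass_norm_le _)).
by lra.
Qed.

HB.instance Definition _ :=
  Uniform_isComplete.Build ultrapower ultrapower_cauchy_cvg.

End ultrapower.

Definition countably_incomplete J (U : set_system J) :=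
  exists A : (set J)^nat, (forall n, U (A n)) /\ \bigcap_n A n = set0.

(* Meaningful for bounded operators only: [sup] of an unbounded set is 0. *)
Definition opnorm {R : realType} {V W : normedModType R} (phi : V -> W) : R :=
  sup [set `|phi y| | y in [set y | `|y| <= 1]].

Section octahedral.
Context {R : realType} (alpha beta : cardinal) (X : completeNormedModType R).

Definition linfty_octahedral :=
  forall Z : set X, Z #< [set: beta] ->
  forall alpha' : cardinal, [set: alpha'] #< [set: alpha] ->
  forall eps : R, 0 < eps ->
  exists phi : {linear linfty alpha' R^o -> X},
    [/\ bounded_near phi (nbhs (0 : linfty alpha' R^o)), opnorm phi <= 1 &
      forall z y, Z z -> `|z + phi y| >= (1 - eps) * (`|z| + `|y|)].

Definition linfty_rigid_octahedral :=
  forall Z : set X, Z #< [set: beta] ->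
  forall alpha' : cardinal, [set: alpha'] #< [set: alpha] ->
  exists phi : {linear linfty alpha' R^o -> X},
    [/\ bounded_near phi (nbhs (0 : linfty alpha' R^o)), opnorm phi <= 1 &
      forall z y, Z z -> `|z + phi y| = `|z| + `|y|].

End octahedral.

(* Main.v *)
(** Over the finite lists [s] of elements of [alpha] and the precisions
    [1 / (m + 1)], take an ultrafilter [U] containing all the tails.  For
    [alpha' < alpha], embedded in [alpha], evaluating a bounded function on
    [alpha'] at the points listed in [s] is a norm-nonincreasing operator into
    a finite-dimensional [linfty], to which the octahedrality of [X] applies with
    [eps = 1 / (m + 1)] and the [(s, m)]-th coordinates of [Z].  The resulting
    operators into [X] induce an operator into the ultrapower.  The errors
    vanish along [U], and every point of [alpha'] is eventually listed in [s],
    so that the supremum norm is recovered in the limit. *)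

From HB Require Import structures.
Require Import Defs.
From mathcomp Require Import all_boot all_order all_algebra.
From mathcomp Require Import all_classical all_reals all_analysis.
Import Order.TTheory GRing.Theory Num.Theory.
Import numFieldNormedType.Exports.
Local Open Scope classical_set_scope.
Local Open Scope card_scope.
Local Open Scope ring_scope.

(** * Comparison of cardinals *)

Section cardinality.

Lemma card_le_lt_trans {T U V : Type} (A : set T) (B : set U) (C : set V) :
  A #<= B -> B #< C -> A #< C.
Proof.
move=> AB /andP[BC CB]; apply/andP; split; first exact: card_le_trans BC.
by apply: contra CB => CA; exact: card_le_trans AB.
Qed.

Lemma card_lt_ord_nat (n : nat) : [set: 'I_n] #< [set: nat].
Proof.
have fn : finite_set [set: 'I_n] by exact: finite_finset.
apply/andP; split; first exact: finite_set_countable.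
by apply/negP => /infiniteP; exact.
Qed.

(** This inverts an injection of [T] into [U]; points off its image go to [None], so that [T] may be
    empty. *)
Lemma card_le_partial_inverse (T U : Type) : [set: T] #<= [set: U] ->
  exists h : U -> option T, forall t, exists u, h u = Some t.
Proof.
have [[u0]|noU] := pselect (inhabited U); last first.
  move=> /card_leP[f]; exists (fun=> None) => t; case: noU.
  have tT : t \in [set: T] by rewrite in_setT.
  exact: (inhabits (val (f (SigSub tT)))).
pose pU : pointedType := HB.pack U (gen_eqMixin U) (gen_choiceMixin U)
  (isPointed.Build U u0).
move=> /(@pcard_injP _ pU)[g ginj].
have /choice[h hP] : forall u, exists o, forall t, g t = u -> o = Some t.
  move=> u; have [[t <-]|nt] := pselect (exists t, g t = u).
    by exists (Some t) => t' /ginj -> //; rewrite in_setT.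
  by exists None => t tu; case: nt; exists t.
by exists h => t; exists (g t); exact: hP.
Qed.

End cardinality.

(** * Operators of norm at most one *)

Section nonexpansive.
Context {R : realType} {V W : normedModType R}.
Implicit Type phi : {linear V -> W}.

(** Boundedness makes the supremum in [opnorm] a true upper bound; the inequality then follows by
    normalizing [y]. *)
Lemma opnorm_le1_nonexpansive phi :
  bounded_near phi (nbhs (0 : V)) -> opnorm phi <= 1 ->
  forall y, `|phi y| <= `|y|.
Proof.
move=> /linear_boundedP/pinfty_ex_gt0[M M0 phiM] phi1 y.
have [->|y0] := eqVneq y 0; first by rewrite linear0 !normr0.
have y_gt0 : 0 < `|y| by rewrite normr_gt0.
suff : `|phi (`|y|^-1 *: y)| <= 1.
  by rewrite linearZ normrZ normfV normr_id ler_pdivrMl// mulr1.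
apply: le_trans phi1; apply: ub_le_sup; last first.
  by exists (`|y|^-1 *: y) => //=; rewrite normrZ normfV normr_id mulVf ?gt_eqF.
exists M => _ [x /= x1 <-]; apply: le_trans (phiM x) _.
by rewrite ler_piMr// ltW.
Qed.

Lemma nonexpansive_bounded_near phi : (forall y, `|phi y| <= `|y|) ->
  bounded_near phi (nbhs (0 : V)).
Proof.
move=> phi1; apply/linear_boundedP; exists 1; split; first exact: num_real.
move=> r r1 x; apply: le_trans (phi1 x) _.
by rewrite ler_peMl// ltW.
Qed.

Lemma nonexpansive_opnorm_le1 phi : (forall y, `|phi y| <= `|y|) ->
  opnorm phi <= 1.
Proof.
move=> phi1; apply: ge_sup; first by exists `|phi 0|, 0 => //=; rewrite normr0.
by move=> _ [y /= y1 <-]; exact: le_trans (phi1 y) y1.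
Qed.

End nonexpansive.

(** * Pullback of bounded functions along a partial map *)

Section linfty_pullback.
Context {R : realType} {S T : Type} {X : normedModType R}.
Variable h : S -> option T.

(** The value 0 where [h] is undefined keeps the pullback linear and nonexpansive. *)
Definition pullback_fun (y : linfty T X) (s : S) : X :=
  if h s is Some t then y t else 0.

Lemma pullback_fun_le (y : linfty T X) s : `|pullback_fun y s| <= `|y|.
Proof.
rewrite /pullback_fun; case: (h s) => [t|]; first exact: linfty_norm_ub.
by rewrite normr0.
Qed.

Fact pullback_bounded (y : linfty T X) :
  pullback_fun y \in @bounded_pred R S X.
Proof. by apply/bounded_predP; exists `|y| => s; exact: pullback_fun_le. Qed.

Definition pullback (y : linfty T X) : linfty S X :=
  Linfty (pullback_bounded y).

Fact pullback_linear : linear pullback.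
Proof.
move=> a f g; apply/val_inj/funext => s /=.
rewrite -[RHS]/(a *: pullback_fun f s + pullback_fun g s) /pullback_fun.
by case: (h s) => [t|] //; rewrite scaler0 addr0.
Qed.
HB.instance Definition _ :=
  GRing.isLinear.Build R (linfty T X) (linfty S X) *:%R pullback
    pullback_linear.

Lemma pullback_norm_le (y : linfty T X) : `|pullback y| <= `|y|.
Proof. by apply: linfty_norm_le => // s; exact: pullback_fun_le. Qed.

Lemma pullback_norm_ge (y : linfty T X) s t :
  h s = Some t -> `|y t| <= `|pullback y|.
Proof.
move=> hs; have := linfty_norm_ub (pullback y) s.
by rewrite -[pullback y s]/(pullback_fun y s) /pullback_fun hs.
Qed.

End linfty_pullback.

(* Unlike [ler_cvg_to], this does not ask for a topology on [J]. *)
Lemma ler_cvg_filter {R : realType} {J : Type} {F : set_system J}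
    {FF : ProperFilter F} (f g : J -> R) (a b : R) :
  f @ F --> a -> g @ F --> b -> (\forall j \near F, f j <= g j) -> a <= b.
Proof.
move=> fa gb fg; have gfba : (g - f) @ F --> b - a by exact: cvgB.
rewrite -subr_ge0 -(cvg_lim (@Rhausdorff R) gfba); apply: limr_ge.
  by apply/cvg_ex; eexists; exact: gfba.
by apply: filterS fg => j; rewrite subr_ge0.
Qed.

(** * Operators into an ultrapower, induced coordinatewise *)

Section ultraoperator.
Context {R : realType} {J : Type} {X : completeNormedModType R}.
Context {U : set_system J} (UF : UltraFilter U) {V : normedModType R}.
Variable psi : J -> {linear V -> X}.
Hypothesis psi1 : forall j y, `|psi j y| <= `|y|.

Fact ultraoperator_bounded y :
  (fun j => psi j y) \in @bounded_pred R J X.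
Proof. by apply/bounded_predP; exists `|y| => j; exact: psi1. Qed.

Definition ultraoperator (y : V) : ultrapower X UF :=
  ultraclass UF (Linfty (ultraoperator_bounded y)).

Fact ultraoperator_linear : linear ultraoperator.
Proof.
move=> a x y; rewrite /ultraoperator -linearZ -raddfD.
congr ultraclass; apply/val_inj/funext => j /=.
exact: linearP.
Qed.
HB.instance Definition _ :=
  GRing.isLinear.Build R V (ultrapower X UF) *:%R ultraoperator
    ultraoperator_linear.

Lemma ultraoperator_norm_le y : `|ultraoperator y| <= `|y|.
Proof.
apply: le_trans (ultraclass_norm_le UF _) _.
by apply: linfty_norm_le => // j; exact: psi1.
Qed.

Lemma cvg_ultraoperator_shift (f : linfty J X) y :
  (fun j => `|f j + psi j y|) @ U --> `|ultraclass UF f + ultraoperator y|.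
Proof.
rewrite /ultraoperator -raddfD.
exact: (@cvg_ultrapower_norm _ _ _ _ UF (f + Linfty (ultraoperator_bounded y))).
Qed.

End ultraoperator.

(** * The index set and its filter of tails *)

Section exhaustion.
Variable T : Type.

(** [{classic T}] supplies the equality test for list membership; the natural number encodes the
    precision and yields countable incompleteness. *)
Definition approx : Type := (seq {classic T} * nat)%type.

Definition approx_tails : set_system approx :=
  [set B | exists j0 : approx, forall j : approx,
    {subset j0.1 <= j.1} -> (j0.2 <= j.2)%N -> B j].

(** The indices are directed: concatenation and maximum bound any two of them, and each tail
    contains its own starting index. *)
Fact approx_tails_proper : ProperFilter approx_tails.
Proof.
split; first by move=> [j0 /(_ j0)]; apply.
split.
- by exists ([::], 0%N).
- move=> A B [a aA] [b bB]; exists (a.1 ++ b.1, maxn a.2 b.2) => j /= sj mj.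
  move: mj; rewrite geq_max => /andP[aj bj]; split.
    by apply: aA => // x xa; apply: sj; rewrite mem_cat xa.
  by apply: bB => // x xb; apply: sj; rewrite mem_cat xb orbT.
- by move=> A B AB [a aA]; exists a => j sj mj; apply/AB/aA.
Qed.

Lemma infinite_approx : infinite_set [set: approx].
Proof.
apply/infiniteP; apply: card_le_trans (card_image_le snd setT).
by apply: subset_card_le => n _; exists ([::], n).
Qed.

(** The indices of precision at least [n] form a tail, and no index lies in all these tails. *)
Lemma approx_tails_incomplete (U : set_system approx) :
  approx_tails `<=` U -> countably_incomplete U.
Proof.
move=> tU; exists (fun n => [set j : approx | (n <= j.2)%N]); split.
  by move=> n; apply: tU; exists ([::], n).
rewrite -subset0 => j /(_ j.2.+1 I) /=.
by rewrite ltnn.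
Qed.

End exhaustion.

(** * Rigid octahedrality of the ultrapower *)

Section octahedral_ultrapower.
Context {R : realType} (kappa : cardinal) (X : completeNormedModType R).
Hypothesis X_octahedral : linfty_octahedral nat kappa X.

(** Composing with [pullback h] reduces to a finite cardinal, hence below [nat]; the price is that
    only the values of [y] at points reached by [h] enter the lower bound. *)
Lemma octahedral_pullback (T : cardinal) (n : nat) (h : 'I_n -> option T)
    (Z : set X) (eps : R) : Z #< [set: kappa] -> 0 < eps ->
  exists psi : {linear linfty T R^o -> X}, (forall y, `|psi y| <= `|y|) /\
    forall z y, Z z -> (1 - eps) * (`|z| + `|pullback h y|) <= `|z + psi y|.
Proof.
move=> Zk eps0.
have [phi [phib phi1 phiZ]] :=
  X_octahedral Z Zk 'I_n (card_lt_ord_nat n) eps eps0.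
exists (phi \o pullback h); split => [y|z y Zz] /=; last exact: phiZ.
apply: le_trans (opnorm_le1_nonexpansive phi phib phi1 _) _.
exact: pullback_norm_le.
Qed.

Lemma ultrapower_rigid_octahedral (alpha : cardinal)
    (U : set_system (approx alpha)) (UF : UltraFilter U) :
  approx_tails alpha `<=` U ->
  linfty_rigid_octahedral alpha kappa (ultrapower X UF).
Proof.
move=> tU Z Zk T /andP[/card_le_partial_inverse[h hT] _].
have /choice[rep repE] := @ultraclassP R _ X U UF.
pose Zj (j : approx alpha) : set X := (fun q => rep q j) @` Z.
pose hj (j : approx alpha) (i : 'I_(size j.1)) := h (tnth (in_tuple j.1) i).
have /choice[psi psiP] : forall j, exists psi : {linear linfty T R^o -> X},
    (forall y, `|psi y| <= `|y|) /\
    forall z y, Zj j z ->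
      (1 - harmonic j.2) * (`|z| + `|pullback (hj j) y|) <= `|z + psi y|.
  move=> j; apply: octahedral_pullback; last exact: harmonic_gt0.
  (* [Zj j] is an image of [Z], hence still smaller than [kappa]. *)
  exact: card_le_lt_trans (card_image_le _ _) Zk.
pose phi : {linear linfty T R^o -> ultrapower X UF} :=
  ultraoperator UF psi (fun j => (psiP j).1).
have phi1 : forall y, `|phi y| <= `|y| by exact: ultraoperator_norm_le.
have harm0 : (fun j : approx alpha => harmonic j.2) @ U --> (0 : R).
  apply: cvg_comp cvg_harmonic => A [n _ nA]; apply: tU.
  by exists ([::], n) => j _ nj; exact: nA.
(* An eventual lower bound [c] stands in for the limit of the pulled-back norms; it is used with
   [c = 0] and with the norm of each [y t]. *)
have lower c z y : Z z ->
    U [set j | c <= `|pullback (hj j) y|] -> `|z| + c <= `|z + phi y|.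
  move=> Zz Uc.
  have lhs : (fun j : approx alpha =>
      (1 - harmonic j.2) * (`|rep z j| + c)) @ U --> (1 - 0) * (`|z| + c).
    apply: cvgM; first by apply: cvgB => //; exact: cvg_cst.
    apply: cvgD; last exact: cvg_cst.
    by rewrite -{2}(repE z); exact: cvg_ultrapower_norm.
  have rhs := cvg_ultraoperator_shift UF psi (fun j => (psiP j).1) (rep z) y.
  move: lhs; rewrite subr0 mul1r => lhs.
  rewrite repE in rhs.
  apply: ler_cvg_filter lhs rhs _; apply: filterS Uc => j /= cj.
  apply: le_trans ((psiP j).2 (rep z j) y _); last by exists z.
  by rewrite ler_wpM2l ?lerD2l// subr_ge0 /harmonic invf_le1 ?ler1n.
exists phi; split.
- exact: nonexpansive_bounded_near.
- exact: nonexpansive_opnorm_le1.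
move=> z y Zz; apply/eqP; rewrite eq_le; apply/andP; split.
  by rewrite (le_trans (ler_normD _ _))// lerD2l.
(* Bounding the supremum norm of [y] pointwise also requires the bound to be nonnegative, which is
   the case [c = 0]. *)
rewrite -lerBrDl; apply: linfty_norm_le => [|t]; rewrite lerBrDl.
  by apply: lower => //; apply: filterE => j /=.
(* With [h u = Some t], every list containing [u] sees the coordinate [t], and such lists form a
   tail. *)
apply: lower => //; apply: tU; have [u hu] := hT t.
exists ([:: u], 0%N) => j uj _ /=.
have /tnthP[i iu] : u \in in_tuple j.1 by apply: uj; rewrite mem_head.
by apply: (@pullback_norm_ge _ _ _ _ _ _ i); rewrite /hj -iu.
Qed.

End octahedral_ultrapower.

Theorem theorem5p2 (R : realType) (kappa : cardinal)
    (kappa_infinite : infinite_set [set: kappa])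
    (X : completeNormedModType R)
    (X_octahedral : linfty_octahedral nat kappa X)
    (alpha : cardinal) (alpha_uncountable : ~ countable [set: alpha]) :
  exists (J : Type) (U : set_system J) (UF : UltraFilter U),
    [/\ infinite_set [set: J], countably_incomplete U &
        linfty_rigid_octahedral alpha kappa (ultrapower X UF)].
Proof.
have [U [UF tU]] := ultraFilterLemma (approx_tails_proper alpha).
exists (approx alpha), U, UF; split.
- exact: infinite_approx.
- exact: approx_tails_incomplete.
- exact: ultrapower_rigid_octahedral.
Qed.
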